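(* Let $\mathcal{A}$ be a $C^*$-algebra, let $\mathcal{M}$ be a pre-Hilbert $\mathcal{A}$-module and let $\mathcal{N}$ be a Hilbert $\mathcal{A}$-module. If $0<p<1$ and a mapping $f:\mathcal{M}\to\mathcal{N}$ satisfies $p$-asymptotically the orthogonality equation, then $f$ is $p$-asymptotically close to a linear isometry mapping; that is, there is a linear isometry $I:\mathcal{M}\to\mathcal{N}$ such that $f$ is $p$-asymptotically close to $I$.
   Context: Let $\mathcal{A}$ be a $C^*$-algebra. A pre-Hilbert $\mathcal{A}$-module is a complex linear space $\mathcal{M}$ which is an algebraic left $\mathcal{A}$-module with $\lambda(ax)=a(\lambda x)=(\lambda a)x$ ($x\in\mathcal{M}$, $a\in\mathcal{A}$, $\lambda\in\mathbb{C}$), equipped with an $\mathcal{A}$-valued inner product $\langle\cdot,\cdot\rangle:\mathcal{M}\times\mathcal{M}\to\mathcal{A}$ satisfying: $\langle x,x\rangle\ge 0$ in $\mathcal{A}$, and $\langle x,x\rangle=0$ iff $x=0$; $\langle\lambda x+y,z\rangle=\lambda\langle x,z\rangle+\langle y,z\rangle$; $\langle ax,y\rangle=a\langle x,y\rangle$; $\langle x,y\rangle^*=\langle y,x\rangle$. It is normed by $\|x\|=\|\langle x,x\rangle\|^{1/2}$, and is called a Hilbert $\mathcal{A}$-module if it is complete in this norm. A mapping $I:\mathcal{M}\to\mathcal{N}$ is an isometry if $\|I(x)-I(y)\|=\|x-y\|$ for all $x,y\in\mathcal{M}$. A mapping $f:\mathcal{M}\to\mathcal{N}$ satisfies $p$-asymptotically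 the orthogonality equation if for each $\varepsilon>0$ there exists $K>0$ such that $\|\langle f(x),f(y)\rangle-\langle x,y\rangle\|\le\varepsilon\|x\|^p\|y\|^p$ for all $x,y\in\mathcal{M}$ with $\max\{\|x\|,\|y\|\}\ge K$. A mapping $f:\mathcal{M}\to\mathcal{N}$ is $p$-asymptotically close to an isometry $I:\mathcal{M}\to\mathcal{N}$ if $\lim_{\|x\|\to\infty}\frac{\|f(x)-I(x)\|}{\|x\|^p}=0$. *)

(* Defs.v *)
From HB Require Import structures.
From mathcomp Require Import all_boot all_order all_algebra.
From mathcomp Require Import complex.
From mathcomp Require Import all_classical all_reals all_analysis.

Set Implicit Arguments.
Unset Strict Implicit.
Unset Printing Implicit Defensive.

Import Order.TTheory GRing.Theory Num.Theory.
Import numFieldNormedType.Exports.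

Local Open Scope classical_set_scope.
Local Open Scope ring_scope.
Local Open Scope complex_scope.

(* C*-algebras need not have a unit, so the product is a new operation on a
   complex Banach space rather than the product of a MathComp ring.           *)
HB.mixin Record isCStarAlgebra (R : realType) (A : Type)
    of CompleteNormedModule R[i] A := {
  amul : A -> A -> A;
  astar : A -> A;
  amulA : forall a b c : A, amul a (amul b c) = amul (amul a b) c;
  amulDl : forall a b c : A, amul (a + b) c = amul a c + amul b c;
  amulDr : forall a b c : A, amul a (b + c) = amul a b + amul a c;
  amulZl : forall (l : R[i]) (a b : A), amul (l *: a) b = l *: amul a b;
  amulZr : forall (l : R[i]) (a b : A), amul a (l *: b) = l *: amul a b;
  ler_normAM : forall a b : A, `|amul a b| <= `|a| * `|b|;
  astarK : forall a : A, astar (astar a) = a;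
  astarD : forall a b : A, astar (a + b) = astar a + astar b;
  astarZ : forall (l : R[i]) (a : A), astar (l *: a) = l^* *: astar a;
  astarM : forall a b : A, astar (amul a b) = amul (astar b) (astar a);
  cstar_identity : forall a : A, `|amul (astar a) a| = `|a| ^+ 2 }.

#[short(type="cstarAlgType")]
HB.structure Definition CStarAlgebra (R : realType) :=
  {A of isCStarAlgebra R A & CompleteNormedModule R[i] A}.

Section CStarAlgebraTheory.
Context {R : realType} {A : cstarAlgType R}.
Implicit Types a : A.

(* The norm of [A] takes its values in the nonnegative reals of R[i]. *)
Definition anorm a : R := complex.Re `|a|.

(* Product of the unitization A (+) C: the pair (a, l) stands for a + l 1. *)
Definition unitization_mul (u v : A * R[i]) : A * R[i] :=
  (amul u.1 v.1 + u.2 *: v.1 + v.2 *: u.1, u.2 * v.2).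

Definition unitization_invertible (u : A * R[i]) : Prop :=
  exists v, unitization_mul u v = (0, 1) /\ unitization_mul v u = (0, 1).

(* Spectrum of [a] in the unitization: the l such that l 1 - a is not
   invertible. When [A] already has a unit it differs from the intrinsic
   spectrum at most by the point 0, which is immaterial for positivity.       *)
Definition spectrum a : set R[i] :=
  [set l | ~ unitization_invertible (- a, l)].

(* For l : R[i], [0 <= l] means that l is real and nonnegative. *)
Definition apos a : Prop :=
  astar a = a /\ spectrum a `<=` [set l | 0 <= l].

End CStarAlgebraTheory.

(* The action of [A] is not required to be unital, even if [A] has a unit. *)
HB.mixin Record isPreHilbertModule (R : realType) (A : cstarAlgType R)
    (M : Type) of GRing.Lmodule R[i] M := {
  lact : A -> M -> M;
  inner : M -> M -> A;
  lactDl : forall (a b : A) (x : M), lact (a + b) x = lact a x + lact b x;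
  lactDr : forall (a : A) (x y : M), lact a (x + y) = lact a x + lact a y;
  lactM : forall (a b : A) (x : M), lact (amul a b) x = lact a (lact b x);
  lactZr : forall (l : R[i]) (a : A) (x : M),
    l *: lact a x = lact a (l *: x);
  lactZl : forall (l : R[i]) (a : A) (x : M),
    lact a (l *: x) = lact (l *: a) x;
  inner_pos : forall x : M, apos (inner x x);
  inner_eq0 : forall x : M, inner x x = 0 <-> x = 0;
  inner_linear : forall (l : R[i]) (x y z : M),
    inner (l *: x + y) z = l *: inner x z + inner y z;
  inner_lact : forall (a : A) (x y : M),
    inner (lact a x) y = amul a (inner x y);
  inner_star : forall x y : M, astar (inner x y) = inner y x }.

#[short(type="preHilbertModType")]
HB.structure Definition PreHilbertModule (R : realType) (A : cstarAlgType R) :=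
  {M of isPreHilbertModule R A M & GRing.Lmodule R[i] M}.

Definition hnorm {R : realType} {A : cstarAlgType R} {M : preHilbertModType A}
  (x : M) : R := Num.sqrt (anorm (inner x x)).

HB.mixin Record isHilbertModule (R : realType) (A : cstarAlgType R)
    (M : Type) of PreHilbertModule R A M := {
  hnorm_complete : forall u : nat -> M,
    (forall e : R, 0 < e -> exists n0 : nat, forall m n : nat,
      (n0 <= m)%N -> (n0 <= n)%N -> hnorm (u m - u n) < e) ->
    exists l : M, hnorm (u n - l) @[n --> \oo] --> (0 : R) }.

#[short(type="hilbertModType")]
HB.structure Definition HilbertModule (R : realType) (A : cstarAlgType R) :=
  {M of isHilbertModule R A M & PreHilbertModule R A M}.

Section AsymptoticOrthogonality.
Context {R : realType} {A : cstarAlgType R} {M N : preHilbertModType A}.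

Definition hisometry (I : M -> N) : Prop :=
  forall x y : M, hnorm (I x - I y) = hnorm (x - y).

(* The filter on [M] of the limits "as the norm of x tends to infinity". *)
Definition hnorm_pinfty : set_system M :=
  [set P | exists K : R, forall x : M, K < hnorm x -> P x].

(* For p != 0, [0 `^ p = 0]. *)
Definition asymp_orthogonality (p : R) (f : M -> N) : Prop :=
  forall e : R, 0 < e -> exists2 K : R, 0 < K &
    forall x y : M, K <= Num.max (hnorm x) (hnorm y) ->
      anorm (inner (f x) (f y) - inner x y)
        <= e * hnorm x `^ p * hnorm y `^ p.

Definition asymp_close (p : R) (f I : M -> N) : Prop :=
  hnorm (f x - I x) / hnorm x `^ p @[x --> hnorm_pinfty] --> (0 : R).

End AsymptoticOrthogonality.

(* Main.v *)
(* The rescalings f((n+1)x)/(n+1) form a Cauchy sequence for each x, because the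
   orthogonality equation makes all their mutual inner products converge to
   <x, x>.  Their limits I x satisfy <I x, I y> = <x, y>, which forces I to be
   linear and isometric, and |f x - I x|^2 expands into inner products that are
   all within o(|x|^(2p)) of <x, x>.

   The limits require the inner product to be continuous, that is, a
   Cauchy-Schwarz inequality up to a constant.  Expanding <tx + sy, tx + sy>
   for s = 1 and s = -1, it reduces to the following: if e + g and e - g are
   positive then |g| <= 4 |e|.  For this, a positive a satisfies
   |t - a| <= t whenever |a| <= t, where t - a acts on the algebra by
   multiplication.  Otherwise the operator norm r of c = t - a would exceed t,
   so r^2 - c^2 would be bounded below, and the geometric sums of (c/r)^2 would
   be bounded.  An arithmetic-geometric mean inequality for operator norms,
   which only uses the C*-identity, shows that they are not. *)

Require Import Defs.
From HB Require Import structures.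
From mathcomp Require Import all_boot all_order all_algebra.
From mathcomp Require Import complex.
From mathcomp Require Import all_classical all_reals all_analysis.
From mathcomp Require Import ring lra.

Import Order.TTheory GRing.Theory Num.Theory.
Import numFieldNormedType.Exports.

Local Open Scope ring_scope.
Local Open Scope complex_scope.

(** * The norm of a C*-algebra *)

Section NormReal.
Context {R : realType} {A : cstarAlgType R}.
Implicit Types a b d : A.

Lemma normE a : `|a| = (anorm a)%:C.
Proof.
have := normr_ge0 a; rewrite lecE => /andP[/eqP /= ia _].
by rewrite /anorm; move: ia; case: (`|a|) => x y /= ->.
Qed.

Lemma anorm_ge0 a : 0 <= anorm a.
Proof. by have := normr_ge0 a; rewrite lecE => /andP[]. Qed.

Lemma ler_anormD a b : anorm (a + b) <= anorm a + anorm b.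
Proof. by have := ler_normD a b; rewrite !normE -rmorphD lecR. Qed.

Lemma anormN a : anorm (- a) = anorm a.
Proof. by rewrite /anorm normrN. Qed.

Lemma anorm0 : anorm (0 : A) = 0.
Proof. by rewrite /anorm normr0. Qed.

Lemma anorm_eq0 a : anorm a = 0 -> a = 0.
Proof. by move=> a0; apply/eqP; rewrite -normr_eq0 normE a0. Qed.

Lemma anormZ (l : R[i]) a : anorm (l *: a) = complex.Re `|l| * anorm a.
Proof.
by rewrite /anorm normrZ normc_def normE /= mul0r subr0.
Qed.

Lemma anormZR (l : R) a : anorm (l%:C *: a) = `|l| * anorm a.
Proof. by rewrite anormZ normc_def /= expr0n addr0 sqrtr_sqr. Qed.

Lemma anormM a b : anorm (amul a b) <= anorm a * anorm b.
Proof. by have := ler_normAM a b; rewrite !normE -rmorphM lecR. Qed.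

Lemma anorm_starM a : anorm (amul (astar a) a) = anorm a ^+ 2.
Proof.
by apply: complexI; have := cstar_identity a; rewrite !normE -rmorphXn.
Qed.

(** The C*-identity and submultiplicativity give |b|^2 <= |b^*| |b|. Cancelling |b| yields one
    inequality, and the involution yields the other. *)
Lemma anorm_star a : anorm (astar a) = anorm a.
Proof.
have le_star b : anorm b <= anorm (astar b).
  have := anorm_ge0 b; rewrite le0r => /orP[/eqP ->|b0].
    exact: anorm_ge0.
  by rewrite -(ler_pM2r b0) -expr2 -anorm_starM anormM.
by apply/le_anti; rewrite le_star -{2}(astarK a) le_star.
Qed.

Lemma amulNr a b : amul a (- b) = - amul a b.
Proof. by rewrite -scaleN1r amulZr scaleN1r. Qed.

Lemma amulNl a b : amul (- a) b = - amul a b.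
Proof. by rewrite -scaleN1r amulZl scaleN1r. Qed.

Lemma amul0r a : amul a 0 = 0.
Proof. by rewrite -(scale0r a) amulZr !scale0r. Qed.

Lemma amul0l a : amul 0 a = 0.
Proof. by rewrite -(scale0r a) amulZl !scale0r. Qed.

Lemma astarN a : astar (- a) = - astar a.
Proof. by rewrite -scaleN1r astarZ rmorphN1 scaleN1r. Qed.

Lemma astar0 : astar (0 : A) = 0.
Proof. by rewrite -(scale0r 0) astarZ rmorph0 !scale0r. Qed.

End NormReal.

(** * Polynomials in a symmetric operator *)

Section PolynomialCalculus.
Context {R : realType} {A : cstarAlgType R} (c : {linear A -> A}).
Implicit Types (p q k w : {poly R[i]}) (b d : A).

(** Horner's scheme for p(c) b. Operator identities thereby reduce to identities in the commutative
    ring [{poly R[i]}]. *)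
Definition poly_act p b : A := foldr (fun l d => l *: b + c d) 0 p.

Lemma poly_act_MXaddC p l b :
  poly_act (p * 'X + l%:P) b = c (poly_act p b) + l *: b.
Proof.
rewrite -cons_poly_def /poly_act polyseq_cons.
case: nilP => [-> /=|_ /=]; last by rewrite addrC.
rewrite raddf0 polyseqC.
by case: eqP => [->|_] /=; rewrite ?scale0r ?raddf0 ?addr0 ?add0r.
Qed.

Lemma poly_act0 b : poly_act 0 b = 0.
Proof. by rewrite /poly_act polyseq0. Qed.

Lemma poly_actC l b : poly_act l%:P b = l *: b.
Proof.
have -> : l%:P = 0 * 'X + l%:P by rewrite mul0r add0r.
by rewrite poly_act_MXaddC poly_act0 raddf0 add0r.
Qed.

Lemma poly_actMX p b : poly_act (p * 'X) b = c (poly_act p b).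
Proof. by rewrite -[p * 'X]addr0 poly_act_MXaddC scale0r addr0. Qed.

Lemma poly_actX b : poly_act 'X b = c b.
Proof. by rewrite -['X]mul1r poly_actMX poly_actC scale1r. Qed.

Lemma poly_actD p q b : poly_act (p + q) b = poly_act p b + poly_act q b.
Proof.
elim/poly_ind: p q => [|p l IH] q; first by rewrite poly_act0 !add0r.
elim/poly_ind: q => [|q m _]; first by rewrite poly_act0 !addr0.
have -> : p * 'X + l%:P + (q * 'X + m%:P) = (p + q) * 'X + (l + m)%:P.
  by rewrite polyCD; ring.
by rewrite !poly_act_MXaddC IH raddfD scalerDl addrACA.
Qed.

Lemma poly_actZ l p b : poly_act (l *: p) b = l *: poly_act p b.
Proof.
elim/poly_ind: p => [|p m IH]; first by rewrite scaler0 poly_act0 scaler0.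
by rewrite scalerDr scalerAl -[l *: m%:P]mul_polyC -polyCM
  !poly_act_MXaddC IH linearZ scalerDr scalerA.
Qed.

Lemma poly_actM p q b : poly_act (p * q) b = poly_act p (poly_act q b).
Proof.
elim/poly_ind: p => [|p l IH]; first by rewrite mul0r !poly_act0.
have -> : (p * 'X + l%:P) * q = p * q * 'X + l *: q.
  by rewrite -mul_polyC; ring.
by rewrite poly_actD poly_actMX poly_actZ IH poly_act_MXaddC.
Qed.

Lemma poly_actB p q b : poly_act (p - q) b = poly_act p b - poly_act q b.
Proof. by rewrite poly_actD -scaleN1r poly_actZ scaleN1r. Qed.

Lemma poly_act1 b : poly_act 1 b = b.
Proof. by rewrite -[1]/(1%:P) poly_actC scale1r. Qed.

(** An upper bound on the operator norm of p(c), with no supremum to construct. *)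
Definition op_bounded p (K : R) : Prop :=
  forall b, anorm (poly_act p b) <= K * anorm b.

Lemma op_boundedM p q K L : 0 <= K ->
  op_bounded p K -> op_bounded q L -> op_bounded (p * q) (K * L).
Proof.
move=> K0 pK qL b; rewrite poly_actM -mulrA.
by apply: le_trans (pK _) _; rewrite ler_wpM2l.
Qed.

Lemma op_boundedD p q K L :
  op_bounded p K -> op_bounded q L -> op_bounded (p + q) (K + L).
Proof.
move=> pK qL b; rewrite poly_actD mulrDl.
by apply: le_trans (ler_anormD _ _) _; rewrite lerD.
Qed.

Lemma op_boundedN p K : op_bounded p K -> op_bounded (- p) K.
Proof. by move=> pK b; rewrite -scaleN1r poly_actZ scaleN1r anormN. Qed.

Lemma op_boundedZ l p K :
  op_bounded p K -> op_bounded (l *: p) (complex.Re `|l| * K).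
Proof.
move=> pK b; rewrite poly_actZ anormZ -mulrA ler_wpM2l //.
by have := normr_ge0 l; rewrite lecE => /andP[].
Qed.

Lemma op_boundedXn p n : op_bounded p 1 -> op_bounded (p ^+ n) 1.
Proof.
move=> p1; elim: n => [|n IH]; first by move=> b; rewrite expr0 poly_act1 mul1r.
by rewrite exprS -[X in op_bounded _ X]mul1r; apply: op_boundedM.
Qed.

(** * Adjoints, the C*-identity for operators and the arithmetic-geometric mean inequality *)

Local Notation conjp := (map_poly Num.conj).

Lemma conjpK p : conjp (conjp p) = p.
Proof. by apply/polyP => i; rewrite !coef_map /= conjCK. Qed.

Hypothesis c_sym : forall b d, amul (astar (c b)) d = amul (astar b) (c d).

(** For the A-valued form b^* d on A, [c] is its own adjoint, so conjugating the coefficients of p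
    gives the adjoint of p(c). *)
Lemma poly_act_adj p b d :
  amul (astar (poly_act p b)) d = amul (astar b) (poly_act (conjp p) d).
Proof.
have act_c q e : poly_act q (c e) = c (poly_act q e).
  by rewrite -poly_actX -poly_actM -poly_actMX.
elim/poly_ind: p d => [|p l IH] d.
  by rewrite rmorph0 !poly_act0 astar0 amul0l amul0r.
rewrite rmorphD rmorphM /= map_polyX map_polyC /= !poly_act_MXaddC.
by rewrite astarD astarZ amulDl amulDr amulZl amulZr c_sym IH act_c.
Qed.

(** With S the adjoint of T = p(c), |S b|^2 = |b^* T S b| <= K |b| |S b|. *)
Lemma op_bounded_conj p K : 0 <= K -> op_bounded p K -> op_bounded (conjp p) K.
Proof.
move=> K0 pK b; have [->|] := eqVneq (anorm (poly_act (conjp p) b)) 0.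
  by rewrite mulr_ge0 ?anorm_ge0.
move=> n0; have n1 : 0 < anorm (poly_act (conjp p) b).
  by rewrite lt_neqAle eq_sym n0 anorm_ge0.
rewrite -(ler_pM2r n1) -expr2 -anorm_starM poly_act_adj conjpK.
apply: le_trans (anormM _ _) _; rewrite anorm_star mulrAC mulrC.
by rewrite ler_wpM2r ?anorm_ge0.
Qed.

(** With S the adjoint of T = p(c), |T b|^2 = |b^* S T b| <= K^2 |b|^2. *)
Lemma op_bounded_sqrt p K : 0 <= K ->
  op_bounded (conjp p * p) (K ^+ 2) -> op_bounded p K.
Proof.
move=> K0 pK b; rewrite -(@ler_pXn2r _ 2) ?nnegrE ?mulr_ge0 ?anorm_ge0 //.
rewrite -anorm_starM poly_act_adj -poly_actM.
apply: le_trans (anormM _ _) _; rewrite anorm_star mulrC exprMn.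
by rewrite expr2 mulrA ler_wpM2r ?anorm_ge0.
Qed.

(** The norm of p(c) is determined by [conjp p * p], so a polynomial can be traded for any other of
    the same modulus. *)
Lemma op_bounded_same_modulus p q K : 0 <= K ->
  conjp p * p = conjp q * q -> op_bounded p K -> op_bounded q K.
Proof.
move=> K0 pq pK; apply: op_bounded_sqrt => //; rewrite -pq expr2.
exact/op_boundedM/pK/op_bounded_conj.
Qed.

(* The arithmetic-geometric mean inequality for the operator norm, from
   [(1 + ik)^2 - (1 - ik)^2 = 4ik] and [|1 + ik|^2 = |1 - ik|^2 = 1 + k^2]. *)
Lemma op_bounded_AMGM x k w L : 0 <= L -> conjp k = k -> conjp w = w ->
  op_bounded (conjp x * x * (1 + k ^+ 2) * w) L ->
  op_bounded (conjp x * x * k * w) (L / 2).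
Proof.
move=> L0 kk ww xL; pose i : {poly R[i]} := ('i)%:P.
have ii : i ^+ 2 = -1 by rewrite -rmorphXn /= sqrCi rmorphN1.
have ci : conjp i = - i by rewrite map_polyC /= conjCi rmorphN.
(* For s = 1 and s = -1, [y s] has the modulus of |x|^2 (1 + k^2) w, hence the bound [L]. The
   difference is 4i x^2 k w, where x^2 has the modulus of |x|^2. *)
pose y s := (x * (1 + s * i * k)) ^+ 2 * w.
have yL (s : {poly R[i]}) : conjp s = s -> s ^+ 2 = 1 -> op_bounded (y s) L.
  move=> cs ss; apply: op_bounded_same_modulus xL => //.
  rewrite !(rmorphM, rmorphD, rmorphXn, rmorph1) /= conjpK kk ww ci cs.
  have -> : (conjp x * (1 + s * - i * k)) ^+ 2 * w *
     ((x * (1 + s * i * k)) ^+ 2 * w) =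
     (conjp x * x * (1 - s ^+ 2 * i ^+ 2 * k ^+ 2) * w) ^+ 2 by ring.
  by rewrite ss ii; ring.
have yB : op_bounded (y 1 - y (-1)) (L + L).
  apply: op_boundedD; first by apply: yL; rewrite ?rmorph1 ?expr1n.
  by apply/op_boundedN/yL; rewrite ?rmorphN1 ?sqrrN ?expr1n.
have z0 : (4%:R * 'i : R[i]) != 0 by rewrite mulf_neq0 ?neq0Ci ?pnatr_eq0.
have xk : op_bounded (x ^+ 2 * k * w) (L / 2).
  have -> : x ^+ 2 * k * w = (4%:R * 'i)^-1 *: (y 1 - y (-1)).
    apply: (scalerI z0); rewrite scalerA divff // scale1r -mul_polyC.
    by rewrite /y rmorphM /= -/i rmorph_nat; ring.
  have -> : L / 2 = complex.Re `|(4%:R * 'i : R[i])^-1| * (L + L).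
    rewrite normfV normrM normCi mulr1 normr_nat.
    have -> : (4%:R : R[i])^-1 = (4^-1)%:C by rewrite fmorphV /= rmorph_nat.
    by rewrite /=; lra.
  exact: op_boundedZ.
apply: op_bounded_same_modulus xk; first by rewrite divr_ge0.
by rewrite !(rmorphM, rmorphXn) /= conjpK kk ww; ring.
Qed.

(** The top factor 1 + k^2, with k = X^(2^m), is the squared modulus of 1 + ik and is absorbed into
    the arbitrary [x]. The induction hypothesis treats the other factors; then AM-GM trades 1 + k^2
    for k and halves the bound. *)
Lemma op_bounded_geometric m x K : 0 <= K ->
  op_bounded (conjp x * x * \prod_(j < m) (1 + ('X ^+ (2 ^ j)) ^+ 2)) K ->
  op_bounded (conjp x * x * 'X ^+ (2 ^ m).-1) (K / 2 ^+ m).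
Proof.
move=> K0; elim: m x K K0 => [|m IH] x K K0 xK.
  by move: xK; rewrite big_ord0 expr0 divr1.
pose i : {poly R[i]} := ('i)%:P; pose k : {poly R[i]} := 'X ^+ (2 ^ m).
have ii : i ^+ 2 = -1 by rewrite -rmorphXn /= sqrCi rmorphN1.
have ci : conjp i = - i by rewrite map_polyC /= conjCi rmorphN.
have ck n : conjp ('X ^+ n) = 'X ^+ n by rewrite rmorphXn /= map_polyX.
have := IH (x * (1 + i * k)) K K0.
rewrite !(rmorphM, rmorphD, rmorph1) /= ci ck -/k.
have -> : conjp x * (1 + - i * k) * (x * (1 + i * k)) =
  conjp x * x * (1 + k ^+ 2).
  have -> : conjp x * x * (1 + k ^+ 2) = conjp x * x * (1 - (-1) * k ^+ 2).
    by ring.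
  by rewrite -ii; ring.
move=> IH'; have {}IH' := IH' _.
rewrite exprSr invfM mulrA.
have -> : conjp x * x * 'X^((2 ^ m.+1).-1) = conjp x * x * k * 'X^((2 ^ m).-1).
  rewrite -[RHS]mulrA -exprD; congr (_ * 'X^_).
  by rewrite expnS mul2n -addnn -subn1 -addnBA ?subn1 // expn_gt0.
apply: op_bounded_AMGM; rewrite ?ck ?divr_ge0 ?exprn_ge0 //.
by apply: IH'; move: xK; rewrite big_ord_recr /= -/k mulrCA mulrC -!mulrA.
Qed.

(** As [c] is symmetric, a bound on c^(2n) gives its square root as a bound on c^n, and this stays
    below 1. *)
Lemma op_bounded_root m L : 0 <= L -> L < 1 ->
  op_bounded ('X ^+ (2 ^ m)) L -> exists2 L', 0 <= L' < 1 & op_bounded 'X L'.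
Proof.
elim: m L => [|m IH] L L0 L1 XL; first by exists L; rewrite ?L0.
apply: (IH (Num.sqrt L)); first exact: sqrtr_ge0.
  by rewrite -sqrtr1 ltr_sqrt.
apply: op_bounded_sqrt; first exact: sqrtr_ge0.
by rewrite sqr_sqrtr // rmorphXn /= map_polyX -exprD addnn -mul2n -expnS.
Qed.

Lemma geometric_sum_factor m :
  (1 - 'X ^+ 2) * \prod_(j < m) (1 + ('X ^+ (2 ^ j)) ^+ 2)
  = 1 - 'X ^+ (2 ^ m.+1) :> {poly R[i]}.
Proof.
elim: m => [|m IH]; first by rewrite big_ord0 mulr1.
rewrite big_ord_recr /= mulrA IH -exprM -expnSr [in RHS]expnSr muln2 -addnn exprD.
by ring.
Qed.

(* If [1 - c^2] is bounded below, the partial sums [1 + c^2 + ... + c^(2n-2)]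
   are bounded; by the AM-GM inequality their norm is at least
   [n |c^(n-1)|] when [n] is a power of two. *)
Lemma op_norm_lt1 (kappa : R) : 0 < kappa -> op_bounded 'X 1 ->
  (forall b, kappa * anorm b <= anorm (b - c (c b))) ->
  exists2 L, 0 <= L < 1 & op_bounded 'X L.
Proof.
move=> k0 X1 below.
pose m := (Num.truncn (4 / kappa)).+1.
have m4 : 4 / kappa < 2 ^+ m.
  have : 4 / kappa < m%:R by rewrite -truncn_lt_nat // divr_ge0 // ltW.
  by move=> /lt_trans; apply; rewrite -natrX ltr_nat ltn_expl.
(* With Z the product, kappa |Z b| <= |(1 - c^2) Z b| = |b - c^(2^(m+1)) b| <= 2 |b|. *)
have Zb : op_bounded (conjp 1 * 1 * \prod_(j < m) (1 + ('X ^+ (2 ^ j)) ^+ 2))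
    (2 / kappa).
  move=> b; rewrite rmorph1 !mul1r mulrAC ler_pdivlMr // mulrC.
  apply: le_trans (below _) _.
  set Z := \prod_(_ < _) _.
  have -> : poly_act Z b - c (c (poly_act Z b)) = poly_act ((1 - 'X ^+ 2) * Z) b.
    by rewrite poly_actM poly_actB poly_act1 expr2 poly_actM !poly_actX.
  rewrite geometric_sum_factor.
  have -> : 2 = 1 + 1 :> R by ring.
  apply: op_boundedD; first by move=> d; rewrite poly_act1 mul1r.
  exact/op_boundedN/op_boundedXn.
have k20 : 0 <= 2 / kappa by rewrite divr_ge0 // ltW.
have := op_bounded_geometric _ _ _ k20 Zb; rewrite rmorph1 !mul1r => Xm.
apply: (op_bounded_root m (2 / kappa / 2 ^+ m)).
- by rewrite divr_ge0 // exprn_ge0.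
- rewrite ltr_pdivrMr ?exprn_gt0 // mul1r; apply: le_lt_trans m4.
  by rewrite ler_pM2r ?invr_gt0 //; lra.
(* One more factor c raises the exponent 2^m - 1 to 2^m, where square roots can be taken. *)
- rewrite -[X in op_bounded _ X]mul1r.
  have -> : 'X ^+ (2 ^ m) = 'X * 'X ^+ (2 ^ m).-1 :> {poly R[i]}.
    by rewrite -exprS prednK ?expn_gt0.
  exact: op_boundedM.
Qed.

End PolynomialCalculus.

(** * Positive elements *)

Section Positivity.
Context {R : realType} {A : cstarAlgType R}.
Implicit Types a b e g : A.

Lemma scaled_mul_linear (r s : R[i]) a :
  linear (fun b => r *: (s *: b - amul a b)).
Proof.
move=> l x y; rewrite amulDr amulZr scalerA [l * r]mulrC -scalerA -scalerDr.
congr (_ *: _); rewrite scalerBr scalerDr !scalerA [s * l]mulrC opprD.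
by rewrite addrACA.
Qed.

(** Left multiplication by r (s - a), an element of the unitization. The two scalars cover both (t -
    a) / r and g / T. *)
Definition scaled_mul (r s : R[i]) a : {linear A -> A} :=
  HB.pack (fun b => r *: (s *: b - amul a b))
    (GRing.isLinear.Build _ _ _ _ _ (scaled_mul_linear r s a)).

Lemma scaled_mul_sym (r s : R) a b d : astar a = a ->
  amul (astar (scaled_mul r%:C s%:C a b)) d =
  amul (astar b) (scaled_mul r%:C s%:C a d).
Proof.
move=> aa; rewrite /= astarZ amulZl amulZr astarD astarN astarM astarZ aa.
have cR (x : R) : (x%:C)^*%R = x%:C by exact: conjc_real.
by rewrite !cR amulDl amulDr amulZl amulZr amulNl amulNr amulA.
Qed.

(** An inverse (v1, v2) of l - a recovers b from l b - a b, so |b| <= (|v1| + |v2|) |l b - a b|.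
    Adding 1 to this constant makes it invertible. *)
Lemma not_spectrum_bounded_below a (l : R[i]) : ~ spectrum a l ->
  exists2 kappa : R, 0 < kappa &
    forall b, kappa * anorm b <= anorm (l *: b - amul a b).
Proof.
move=> /contrapT[[v1 v2] [_]]; rewrite /unitization_mul /= => -[v12 v2l].
pose K := anorm v1 + complex.Re `|v2|.
have Re0 : 0 <= complex.Re `|v2|.
  by have := normr_ge0 v2; rewrite lecE => /andP[].
have K0 : 0 <= K by rewrite addr_ge0 ?anorm_ge0.
exists (K + 1)^-1; first by rewrite invr_gt0 ltr_wpDl.
move=> b; rewrite mulrC ler_pdivrMr ?ltr_wpDl // mulrC.
have {1}-> : b = amul v1 (l *: b - amul a b) + v2 *: (l *: b - amul a b).
  have := congr1 (fun x => amul x b) v12.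
  rewrite amul0l !amulDl !amulZl !amulNr amulNl amulNl -amulA => v12b.
  rewrite amulDr amulNr amulZr scalerBr scalerA v2l scale1r addrCA -addrA.
  by rewrite -scalerN [l *: _ + _]addrC v12b addr0.
apply: le_trans (ler_anormD _ _) _; rewrite mulrDl mul1r /K mulrDl anormZ.
apply: (@le_trans _ _ (anorm v1 * anorm (l *: b - amul a b) +
    complex.Re `|v2| * anorm (l *: b - amul a b))).
  by rewrite lerD2r anormM.
by rewrite lerDl anorm_ge0.
Qed.

(** Let r be the operator norm of D = t - a. If r > t, then D - r and D + r are both bounded below,
    hence so is 1 - (D/r)^2. This makes the norm of D/r less than 1, against the choice of r. *)
Lemma apos_mul_contraction a (t : R) : apos a -> anorm a <= t ->
  forall b, anorm (t%:C *: b - amul a b) <= t * anorm b.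
Proof.
move=> [aa spa] at_.
have t0 : 0 <= t by exact: le_trans (anorm_ge0 _) at_.
pose S : set R := [set K | 0 <= K /\
  forall b, anorm (t%:C *: b - amul a b) <= K * anorm b]%classic.
have S2t : S (t + t).
  split=> [|b]; first by rewrite addr_ge0.
  apply: le_trans (ler_anormD _ _) _; rewrite anormN anormZR ger0_norm // mulrDl.
  by rewrite lerD2l (le_trans (anormM _ _)) // ler_wpM2r ?anorm_ge0.
have S0 : lbound S 0 by move=> K [].
have infS : has_inf S by split; [exists (t + t) | exists 0].
pose r := inf S.
have Sr b : anorm (t%:C *: b - amul a b) <= r * anorm b.
  have := anorm_ge0 b; rewrite le0r => /orP[/eqP b0|b0].
    by have [_ /(_ b)] := S2t; rewrite b0 !mulr0.
  rewrite -ler_pdivrMr //; apply: lb_le_inf; first by exists (t + t).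
  by move=> K [_ /(_ b) Kb]; rewrite ler_pdivrMr.
have [rt b|tr] := leP r t.
  by apply: le_trans (Sr b) _; rewrite ler_wpM2r ?anorm_ge0.
exfalso; have r0 : 0 < r by exact: le_lt_trans tr.
have rV0 : 0 <= r^-1 by rewrite invr_ge0 ltW.
pose c := scaled_mul (r^-1)%:C t%:C a.
have c1 : op_bounded c 'X 1.
  move=> b; rewrite poly_actX mul1r /c /= anormZR ger0_norm //.
  by rewrite mulrC ler_pdivrMr // mulrC.
have rC : (r%:C : R[i]) != 0 by rewrite fmorph_eq0 gt_eqF.
(* The negative number t - r lies outside the spectrum of [a]. *)
have [k k0 kP] : exists2 kappa : R, 0 < kappa &
    forall b, kappa * anorm b <= anorm (- (r - t)%:C *: b - amul a b).
  apply: not_spectrum_bounded_below => /spa /=.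
  rewrite -rmorphN lecE /= => /andP[_]; rewrite oppr_ge0 subr_le0 => /le_lt_trans.
  by move=> /(_ _ tr); rewrite ltxx.
have [D DE] : exists D : {linear A -> A}, forall b, t%:C *: b - amul a b = D b.
  by exists (scaled_mul 1 t%:C a) => b /=; rewrite scale1r.
have cE b : c b = r%:C^-1 *: D b by rewrite -DE /c /= fmorphV.
have below b : (k / r) * anorm b <= anorm (b - c (c b)).
  pose d := r%:C *: b + D b.
  have shiftE e : - (r - t)%:C *: e - amul a e = D e - r%:C *: e.
    by rewrite -DE rmorphB opprB scalerBl addrAC.
  have -> : b - c (c b) = (r^-1 ^+ 2)%:C *: - (D d - r%:C *: d).
    rewrite !cE [D (_ *: _)]linearZ /= scalerA -expr2 rmorphXn fmorphV /= /d.
    rewrite [D (_ + _)]linearD [D (_ *: _)]linearZ /=.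
    rewrite [r%:C *: (_ + _)]scalerDr opprB addrKA scalerBr scalerA.
    by rewrite scalerA -expr2 -exprMn mulVf // expr1n scale1r.
  rewrite anormZR anormN -shiftE ger0_norm ?exprn_ge0 //.
  apply: le_trans (ler_wpM2l _ (kP d)); last by rewrite exprn_ge0.
  (* Here d = (r + t) b - a b, and |a| <= t. *)
  have db : r * anorm b <= anorm d.
    have -> : r = (r + t) - t by ring.
    rewrite mulrBl lerBlDr.
    have <- : anorm (d + amul a b) = (r + t) * anorm b.
      rewrite /d -DE -addrA subrK -scalerDl -rmorphD anormZR ger0_norm //.
      by rewrite addr_ge0 // ltW.
    apply: le_trans (ler_anormD _ _) _; rewrite lerD2l.
    by rewrite (le_trans (anormM _ _)) // ler_wpM2r ?anorm_ge0.
  have -> : k / r * anorm b = r^-1 ^+ 2 * (k * (r * anorm b)).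
    by field; rewrite gt_eqF.
  by apply: ler_wpM2l; rewrite ?exprn_ge0 //; apply: ler_wpM2l; rewrite // ltW.
have [L /andP[L0 L1] LP] := op_norm_lt1 c
  (fun b d => scaled_mul_sym _ _ _ b d aa) _ (divr_gt0 k0 r0) c1 below.
have : S (r * L).
  split=> [|b]; first by rewrite mulr_ge0 // ltW.
  have := LP b; rewrite poly_actX /c /= anormZR ger0_norm //.
  by rewrite ler_pdivrMl // mulrA.
move=> /(inf_lbound (ex_intro _ 0 S0)).
by rewrite -/r leNgt gtr_pMr // L1.
Qed.

(** With T = |g| + C, the contraction bound for e + g and e - g shows that T - g and T + g have
    operator norm at most T + C. For c = g / T, the squares of 1 + c and 1 - c average to 1 + c^2,
    so AM-GM bounds c by (1 + C/T)^2 / 2. *)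
Lemma apos_perturbation_le (e g : A) (C : R) : astar g = g -> anorm e <= C ->
  apos (e + g) -> apos (e - g) -> anorm g <= 4 * C.
Proof.
move=> gg eC pg mg; pose T := anorm g + C.
have C0 : 0 <= C by exact: le_trans (anorm_ge0 _) eC.
have g0 := anorm_ge0 g.
have [T0|T0] := leP T 0; first by move: T0; rewrite /T; lra.
have bound h : anorm h <= anorm g -> apos (e - h) ->
    forall b, anorm (T%:C *: b + amul h b) <= (T + C) * anorm b.
  move=> hg ph b; have -> : T%:C *: b + amul h b =
      (T%:C *: b - amul (e - h) b) + amul e b.
    by rewrite amulDl amulNl opprB addrA subrK.
  apply: le_trans (ler_anormD _ _) _; rewrite mulrDl lerD //.
    apply: apos_mul_contraction => //; apply: le_trans (ler_anormD _ _) _.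
    by rewrite anormN /T addrC lerD.
  by apply: le_trans (anormM _ _) _; rewrite ler_wpM2r ?anorm_ge0.
pose c := scaled_mul (T^-1)%:C 0%:C (- g).
have cE b : c b = (T^-1)%:C *: amul g b.
  by rewrite /c /= scale0r sub0r amulNl opprK.
have Xs (s : R[i]) h : `|s| = 1 -> amul h = (fun b => s *: amul g b) ->
    anorm h <= anorm g -> apos (e - h) ->
    op_bounded c (1 + s *: 'X) ((T + C) / T).
  move=> s1 hs hg ph b; rewrite poly_actD poly_act1 poly_actZ poly_actX cE.
  have -> : b + s *: ((T^-1)%:C *: amul g b) =
      (T^-1)%:C *: (T%:C *: b + amul h b).
    rewrite hs scalerDr !scalerA -rmorphM mulVf ?gt_eqF // scale1r.
    by rewrite [s * _]mulrC.
  rewrite anormZR ger0_norm ?invr_ge0 ?(ltW T0) // ler_pdivrMl //.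
  have -> : T * ((T + C) / T * anorm b) = (T + C) * anorm b.
    by field; rewrite gt_eqF.
  exact: bound.
pose tau := (T + C) / T.
have tau0 : 0 <= tau by rewrite divr_ge0 ?addr_ge0 // ltW.
have X1 : op_bounded c (1 + 1 *: 'X) tau.
  by apply: (Xs 1 g); rewrite ?normr1 //; apply/funext => b; rewrite scale1r.
have X2 : op_bounded c (1 + (-1) *: 'X) tau.
  apply: (Xs (-1) (- g)); rewrite ?normrN1 ?anormN ?opprK //.
  by apply/funext => b; rewrite scaleN1r amulNl.
have X3 : op_bounded c (map_poly Num.conj 1 * 1 * (1 + 'X ^+ 2) * 1) (tau ^+ 2).
  rewrite rmorph1.
  have -> : 1 * 1 * (1 + 'X ^+ 2) * 1 =
      real_complex R (1 / 2 : R) *: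
      ((1 + 1 *: 'X) ^+ 2 + (1 + (-1) *: 'X) ^+ 2) :> {poly R[i]}.
    rewrite scale1r scaleN1r.
    have -> : (1 + 'X) ^+ 2 + (1 - 'X) ^+ 2
        = 2%:R *: (1 + 'X ^+ 2) :> {poly R[i]}.
      by rewrite scaler_nat; ring.
    have half2 : real_complex R (1 / 2) * 2%:R = 1.
      by rewrite mul1r fmorphV rmorph_nat mulVf ?pnatr_eq0.
    by rewrite scalerA half2 scale1r; ring.
  have -> : tau ^+ 2 = complex.Re `|(1 / 2 : R)%:C| * (tau * tau + tau * tau).
    rewrite normc_def /= expr0n addr0 sqrtr_sqr ger0_norm //; lra.
  by apply/op_boundedZ/op_boundedD; rewrite expr2; apply: op_boundedM.
(* The operator bound is evaluated at [g] itself, where |g g| = |g|^2 because g is selfadjoint. *)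
have := op_bounded_AMGM c (fun b d => scaled_mul_sym _ _ _ b d _) 1 'X 1 _
  (exprn_ge0 2 tau0) _ _ X3.
rewrite astarN gg rmorph1 map_polyX !mul1r mulr1 => /(_ erefl erefl erefl g).
rewrite poly_actX cE anormZR ger0_norm ?invr_ge0 ?(ltW T0) //.
rewrite -{1}gg anorm_starM.
have [->|gn0] := eqVneq (anorm g) 0; first by rewrite mulr_ge0.
have gp : 0 < anorm g by rewrite lt_neqAle eq_sym gn0.
rewrite expr2 mulrA ler_pM2r // mulrC ler_pdivrMr //.
have -> : tau ^+ 2 / 2 * T = (T + C) ^+ 2 / (2 * T).
  by rewrite /tau; field; rewrite gt_eqF.
(* [H] amounts to |g|^2 <= 2 C |g| + 4 C^2, so |g| <= (1 + sqrt 5) C, which is rounded up to 4 C. *)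
rewrite ler_pdivlMr ?mulr_gt0 // /T => H.
rewrite leNgt; apply/negP => H4.
have G4 : 0 < anorm g * (anorm g - 4 * C) by rewrite mulr_gt0 // subr_gt0.
have C4 : 0 <= C * (anorm g - 4 * C) by rewrite mulr_ge0 // subr_ge0 ltW.
by clear - H G4 C4; move: (anorm g) H G4 C4 => G; nra.
Qed.

End Positivity.

(** * The Cauchy-Schwarz inequality *)

Section PreHilbert.
Context {R : realType} {A : cstarAlgType R} {M : preHilbertModType A}.
Implicit Types x y z : M.

Lemma innerDl x y z : inner (x + y) z = inner x z + inner y z.
Proof. by rewrite -{1}[x]scale1r inner_linear scale1r. Qed.

Lemma inner0l z : inner 0 z = 0.
Proof. by apply: (addrI (inner 0 z)); rewrite -innerDl !addr0. Qed.

Lemma innerZl (l : R[i]) x z : inner (l *: x) z = l *: inner x z.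
Proof. by rewrite -[l *: x]addr0 inner_linear inner0l addr0. Qed.

Lemma innerDr x y z : inner x (y + z) = inner x y + inner x z.
Proof. by rewrite -inner_star innerDl astarD !inner_star. Qed.

Lemma innerZr (l : R[i]) x z : inner x (l *: z) = l^*%R *: inner x z.
Proof. by rewrite -inner_star innerZl astarZ inner_star. Qed.

Lemma innerBl x y z : inner (x - y) z = inner x z - inner y z.
Proof. by rewrite innerDl -scaleN1r innerZl scaleN1r. Qed.

Lemma innerBr x y z : inner x (y - z) = inner x y - inner x z.
Proof. by rewrite innerDr -scaleN1r innerZr rmorphN1 scaleN1r. Qed.

Lemma anorm_innerC x y : anorm (inner x y) = anorm (inner y x).
Proof. by rewrite -inner_star anorm_star. Qed.

Lemma hnorm_ge0 x : 0 <= hnorm x.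
Proof. exact: sqrtr_ge0. Qed.

Lemma sqr_hnorm x : hnorm x ^+ 2 = anorm (inner x x).
Proof. by rewrite sqr_sqrtr // anorm_ge0. Qed.

Lemma hnorm_eq0 x : hnorm x = 0 -> x = 0.
Proof.
by move=> x0; apply/inner_eq0/anorm_eq0; rewrite -sqr_hnorm x0 expr0n.
Qed.

Lemma hnormZ (l : R[i]) x : hnorm (l *: x) = complex.Re `|l| * hnorm x.
Proof.
have Re0 : 0 <= complex.Re `|l|.
  by have := normr_ge0 l; rewrite lecE => /andP[].
rewrite /hnorm innerZl innerZr !anormZ norm_conjC mulrA -expr2.
by rewrite sqrtrM ?sqr_ge0 // sqrtr_sqr ger0_norm.
Qed.

Lemma hnorm_natZ n x : hnorm (n%:R *: x) = n%:R * hnorm x.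
Proof. by rewrite hnormZ normr_nat -[n%:R](rmorph_nat (real_complex R)). Qed.

Lemma anorm_inner_re_le x y :
  anorm (inner x y + inner y x) <= 8 * hnorm x * hnorm y.
Proof.
have [x0|xn0] := eqVneq (hnorm x) 0.
  rewrite (hnorm_eq0 _ x0) inner0l add0r -anorm_innerC inner0l anorm0.
  by rewrite !mulr_ge0 ?hnorm_ge0.
have [y0|yn0] := eqVneq (hnorm y) 0.
  rewrite (hnorm_eq0 _ y0) inner0l addr0 anorm_innerC inner0l anorm0.
  by rewrite !mulr_ge0 ?hnorm_ge0.
have xp : 0 < hnorm x by rewrite lt_neqAle eq_sym xn0 hnorm_ge0.
have yp : 0 < hnorm y by rewrite lt_neqAle eq_sym yn0 hnorm_ge0.
(* This t makes t |x| = |y|, so the bound 4 (t^2 |x|^2 + |y|^2) becomes 8 |y|^2 = t (8 |x| |y|). *)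
pose t := hnorm y / hnorm x; have tp : 0 < t by rewrite divr_gt0.
have cR (r : R) : (r%:C)^*%R = r%:C by exact: conjc_real.
pose e := (t ^+ 2)%:C *: inner x x + inner y y.
pose g := t%:C *: (inner x y + inner y x).
have eE : anorm e <= t ^+ 2 * hnorm x ^+ 2 + hnorm y ^+ 2.
  apply: le_trans (ler_anormD _ _) _; rewrite anormZR ger0_norm ?sqr_ge0 //.
  by rewrite !sqr_hnorm.
have gg : astar g = g by rewrite astarZ cR astarD !inner_star addrC.
have pos (s : R) : s ^+ 2 = 1 -> apos (e + s%:C *: g).
  move=> s1; have := inner_pos (t%:C *: x + s%:C *: y).
  congr apos; rewrite /e /g.
  rewrite !(innerDl, innerDr) !(innerZl, innerZr) !cR !scalerA.
  rewrite -!rmorphM -!expr2 s1 scale1r [s * t]mulrC scalerDr.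
  set a := _ *: inner x x; set b := _ *: inner x y; set d := _ *: inner y x.
  by rewrite [d + _]addrC addrACA.
have := apos_perturbation_le _ _ _ gg eE.
have := pos 1; rewrite expr1n scale1r => /(_ erefl) p1 /(_ p1).
have := pos (-1); rewrite sqrrN expr1n rmorphN1 scaleN1r => /(_ erefl) p2 /(_ p2).
rewrite /g anormZR (ger0_norm (ltW tp)) => H.
rewrite -(ler_pM2l tp); apply: le_trans H _.
by rewrite /t le_eqVlt; apply/orP; left; apply/eqP; field.
Qed.

(* The sharp constant is 1, but only continuity of the inner product matters. *)
Lemma anorm_inner_le x y : anorm (inner x y) <= 8 * hnorm x * hnorm y.
Proof.
have two : (2 : R[i]) = (2 : R)%:C by rewrite rmorph_nat.
have H1 := anorm_inner_re_le x y.
(* Replacing x by ix turns the bound on the real part of <x, y> into one on its imaginary part. *)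
have := anorm_inner_re_le ('i *: x) y.
rewrite innerZl innerZr conjCi hnormZ normCi /= mul1r => H2.
have : 2 * anorm (inner x y) <= 2 * (8 * hnorm x * hnorm y).
  rewrite -[X in X * anorm _]ger0_norm // -anormZR -two.
  have -> : 2 *: inner x y = (inner x y + inner y x) -
     'i *: ('i *: inner x y + - 'i *: inner y x).
    rewrite scalerDr !scalerA mulrN -expr2 sqrCi opprK !scaleN1r scale1r.
    by rewrite opprD opprK addrACA subrr addr0 scaler_nat mulr2n.
  apply: le_trans (ler_anormD _ _) _.
  by rewrite anormN anormZ normCi /= mul1r [2 * _]mulr_natl mulr2n lerD.
by rewrite ler_pM2l.
Qed.

End PreHilbert.

(** * Rescaled maps and their limits *)

Section Limits.
Context {R : realType} {A : cstarAlgType R} {M N : preHilbertModType A}.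

Lemma anorm_inner_limit (u : nat -> N) (l v : N) (a : A) (eta : R) (n0 : nat) :
  (hnorm (u n - l) @[n --> \oo] --> (0 : R))%classic ->
  (forall n, (n0 <= n)%N -> anorm (inner (u n) v - a) <= eta) ->
  anorm (inner l v - a) <= eta.
Proof.
move=> /cvgrPdist_lt ul uv; apply/ler_addgt0Pr => d d0.
(* The [+ 1] keeps the divisor positive when v = 0. *)
have C0 : 0 < 8 * hnorm v + 1 by rewrite ltr_wpDl // mulr_ge0 // hnorm_ge0.
have [n1 _ n1P] := ul _ (divr_gt0 d0 C0).
pose n := maxn n0 n1.
have := n1P n (leq_maxr _ _); rewrite /= sub0r normrN ger0_norm ?hnorm_ge0 //.
rewrite ltr_pdivlMr // => und.
have -> : inner l v - a = inner (u n) v - a - inner (u n - l) v.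
  by rewrite innerBl addrAC opprB [inner (u n) v + _]addrC subrK.
apply: le_trans (ler_anormD _ _) _; rewrite anormN lerD ?uv ?leq_maxl //.
apply: le_trans (anorm_inner_le _ _) _; apply: le_trans (ltW und).
by rewrite [8 * _]mulrC -mulrA ler_wpM2l ?hnorm_ge0 // lerDl.
Qed.

(** In the expansion of <x - y, x - y> the four copies of <z, z> cancel, leaving four errors of norm
    at most [eta]. *)
Lemma sqr_hnormB_le (x y : N) (z : M) (eta : R) :
  anorm (inner x x - inner z z) <= eta ->
  anorm (inner x y - inner z z) <= eta ->
  anorm (inner y y - inner z z) <= eta -> hnorm (x - y) ^+ 2 <= 4 * eta.
Proof.
move=> xx xy yy; rewrite sqr_hnorm.
have yx : anorm (inner y x - inner z z) <= eta.
  by rewrite -[inner y x]inner_star -[inner z z]inner_star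
    -astarN -astarD anorm_star.
have -> : inner (x - y) (x - y) =
    (inner x x - inner z z) - (inner x y - inner z z)
    - ((inner y x - inner z z) - (inner y y - inner z z)).
  rewrite innerBl !innerBr; congr (_ - _);
  by rewrite opprB addrA subrK.
have -> : 4 * eta = (eta + eta) + (eta + eta) by ring.
do 2 (apply: le_trans (ler_anormD _ _) _; rewrite ?anormN lerD //).
Qed.

Variables (p : R) (f : M -> N).
Hypothesis p_lt1 : p < 1.

(** The shift to n + 1 avoids dividing by zero and makes [f] the rescaling of index 0. *)
Definition rescaling (n : nat) (x : M) : N := n.+1%:R^-1 *: f (n.+1%:R *: x).

Lemma rescaling0 x : rescaling 0 x = f x.
Proof. by rewrite /rescaling invr1 !scale1r. Qed.

Lemma inner_rescaling n m x y :
  anorm (inner (rescaling n x) (rescaling m y) - inner x y) =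
  (n.+1%:R * m.+1%:R)^-1 *
  anorm (inner (f (n.+1%:R *: x)) (f (m.+1%:R *: y)) -
         inner (n.+1%:R *: x) (m.+1%:R *: y)).
Proof.
have cn k : ((k.+1%:R : R[i])^-1)^*%R = k.+1%:R^-1 by rewrite fmorphV rmorph_nat.
have n0 k : (k.+1%:R : R[i]) != 0 by rewrite pnatr_eq0.
have -> : inner (rescaling n x) (rescaling m y) - inner x y =
  (n.+1%:R * m.+1%:R)^-1 *: (inner (f (n.+1%:R *: x)) (f (m.+1%:R *: y)) -
         inner (n.+1%:R *: x) (m.+1%:R *: y)).
  rewrite /rescaling !innerZl !innerZr cn rmorph_nat scalerBr !scalerA invfM.
  congr (_ - _); rewrite -[LHS]scale1r; congr (_ *: _).
  move: (n0 n) (n0 m); move: n.+1%:R m.+1%:R => s t s0 t0.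
  by field; rewrite s0 t0.
rewrite anormZ; congr (_ * _).
rewrite ger0_norm ?invr_ge0 ?mulr_ge0 //.
have -> : (n.+1%:R * m.+1%:R : R[i])^-1 = ((n.+1%:R * m.+1%:R)^-1)%:C.
  by rewrite fmorphV rmorphM /= !rmorph_nat.
by [].
Qed.

(** As p < 1, (n+1)^p <= n+1, which the normalization absorbs. The bound is uniform in n and m;
    smallness comes from the choice of [e]. *)
Lemma inner_rescaling_le (e K : R) (n m : nat) (x y : M) :
  (forall x y : M, K <= Num.max (hnorm x) (hnorm y) ->
    anorm (inner (f x) (f y) - inner x y) <= e * hnorm x `^ p * hnorm y `^ p) ->
  0 <= e -> K <= Num.max (n.+1%:R * hnorm x) (m.+1%:R * hnorm y) ->
  anorm (inner (rescaling n x) (rescaling m y) - inner x y)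
    <= e * (hnorm x `^ p * hnorm y `^ p).
Proof.
move=> fK e0 Kle; rewrite inner_rescaling ler_pdivrMl ?mulr_gt0 ?ltr0n //.
apply: le_trans (fK _ _ _) _; first by rewrite !hnorm_natZ.
have powS k (z : M) : hnorm (k.+1%:R *: z) `^ p <= k.+1%:R * hnorm z `^ p.
  rewrite hnorm_natZ powRM ?hnorm_ge0 // ler_wpM2r ?powR_ge0 //.
  by rewrite ler1_powR ?ler1n // ltW.
have -> : n.+1%:R * m.+1%:R * (e * (hnorm x `^ p * hnorm y `^ p)) =
  e * ((n.+1%:R * hnorm x `^ p) * (m.+1%:R * hnorm y `^ p)) by ring.
by rewrite -mulrA ler_wpM2l // ler_pM ?powR_ge0.
Qed.

Hypothesis hf : asymp_orthogonality p f.

Lemma inner_rescaling_cvg (x y : M) (eta : R) : 0 < eta ->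
  exists n0 : nat, forall n m, (n0 <= n)%N -> (n0 <= m)%N ->
    anorm (inner (rescaling n x) (rescaling m y) - inner x y) <= eta.
Proof.
move=> eta0.
have large (K a : R) : 0 <= K -> 0 < a ->
    exists n0 : nat, forall n, (n0 <= n)%N -> K <= n.+1%:R * a.
  move=> K0 a0; exists (Num.truncn (K / a)) => n; rewrite -ltnS.
  by rewrite truncn_lt_nat ?divr_ge0 ?(ltW a0) // ltr_pdivrMr // => /ltW.
pose C := hnorm x `^ p * hnorm y `^ p.
have C0 : 0 <= C by rewrite mulr_ge0 ?powR_ge0.
have C1 : 0 < C + 1 by rewrite ltr_wpDl.
have [K K0 fK] := hf _ (divr_gt0 eta0 C1).
have CE : eta / (C + 1) * C <= eta.
  by rewrite mulrAC ler_pdivrMr // ler_wpM2l ?(ltW eta0) // lerDl.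
have [x0|xn0] := eqVneq (hnorm x) 0; last first.
  have xp : 0 < hnorm x by rewrite lt_neqAle eq_sym xn0 hnorm_ge0.
  have [n0 n0P] := large K _ (ltW K0) xp; exists n0 => n m n0n n0m.
  apply: le_trans CE; apply: inner_rescaling_le fK _ _.
    by rewrite divr_ge0 // ltW.
  by rewrite le_max n0P.
have [y0|yn0] := eqVneq (hnorm y) 0; last first.
  have yp : 0 < hnorm y by rewrite lt_neqAle eq_sym yn0 hnorm_ge0.
  have [n0 n0P] := large K _ (ltW K0) yp; exists n0 => n m n0n n0m.
  apply: le_trans CE; apply: inner_rescaling_le fK _ _.
    by rewrite divr_ge0 // ltW.
  by rewrite le_max n0P ?orbT.
(* At x = y = 0 no rescaling reaches norm K, but the error is |<f 0, f 0>| / ((n+1)(m+1)), which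
   tends to 0. *)
rewrite (hnorm_eq0 _ x0) (hnorm_eq0 _ y0).
have [n0 n0P] := large _ _ (anorm_ge0 (inner (f 0) (f 0))) eta0.
exists n0 => n m n0n n0m; rewrite inner_rescaling !scaler0 inner0l subr0.
rewrite ler_pdivrMl ?mulr_gt0 ?ltr0n //; apply: le_trans (n0P _ n0n) _.
by rewrite ler_pM2r // ler_peMr ?ler1n.
Qed.

End Limits.

(** * Construction of the isometry and the asymptotic estimate *)

Theorem theorem3p2 (R : realType) (A : cstarAlgType R)
    (M : preHilbertModType A) (N : hilbertModType A)
    (p : R) (hp0 : 0 < p) (hp1 : p < 1)
    (f : M -> N) (hf : asymp_orthogonality p f) :
  exists I : {linear M -> N}, hisometry I /\ asymp_close p f I.
Proof.
have cvg_u x : exists l : N,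
    (hnorm (rescaling f n x - l) @[n --> \oo] --> (0 : R))%classic.
  apply: hnorm_complete => e e0.
  (* The four errors in the squared distance then add up to e^2 / 2 < e^2. *)
  have e4 : 0 < e ^+ 2 / 8 by rewrite divr_gt0 // exprn_gt0.
  have [n0 n0P] := inner_rescaling_cvg p f hp1 hf x x _ e4.
  exists n0 => m n n0m n0n.
  rewrite -(@ltr_pXn2r _ 2) ?nnegrE ?hnorm_ge0 ?(ltW e0) //.
  apply: le_lt_trans (sqr_hnormB_le _ _ x (e ^+ 2 / 8) _ _ _) _; try exact: n0P.
  have : 0 < e ^+ 2 by rewrite exprn_gt0.
  by lra.
have [I cvgI] := choice cvg_u.
(* The involution carries the limit in the first argument over to the second. *)
have I_limit (x : M) (v : N) (a : A) (eta : R) (n0 : nat) :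
    (forall n, (n0 <= n)%N -> anorm (inner v (rescaling f n x) - a) <= eta) ->
    anorm (inner v (I x) - a) <= eta.
  move=> va; rewrite -inner_star -[a]astarK -astarN -astarD anorm_star.
  apply: (anorm_inner_limit _ _ _ _ _ n0 (cvgI x)) => n /va.
  by rewrite -inner_star -{1}[a]astarK -astarN -astarD anorm_star.
have innerI x y : inner (I x) (I y) = inner x y.
  apply/subr0_eq/anorm_eq0/le_anti; rewrite anorm_ge0 andbT.
  apply/ler_addgt0Pr => eta eta0; rewrite add0r.
  have [n0 n0P] := inner_rescaling_cvg p f hp1 hf x y _ eta0.
  apply: (anorm_inner_limit _ _ _ _ _ n0 (cvgI x)) => n n0n.
  by apply: (I_limit _ _ _ _ n0) => m n0m; exact: n0P.
have linI : linear I.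
  move=> l x y; apply/subr0_eq; set d := _ - _.
  (* The linearity defect [d] is orthogonal to the range of [I] and is itself a combination of
     elements of that range, so <d, d> = 0. *)
  have d0 z : inner d (I z) = 0.
    by rewrite /d innerBl inner_linear !innerI inner_linear subrr.
  apply/inner_eq0; rewrite {2}/d innerBr innerDr innerZr !d0.
  by rewrite scaler0 addr0 subrr.
pose L : {linear M -> N} := HB.pack I (GRing.isLinear.Build _ _ _ _ _ linI).
exists L; split.
  move=> x y; rewrite -[L x - L y]linearB.
  by rewrite /hnorm [inner (L _) _]innerI.
move=> B /nbhs_ballP[e /= e0 eB].
have e4 : 0 < e ^+ 2 / 8 by rewrite divr_gt0 // exprn_gt0.
have [K K0 fK] := hf _ e4.
exists K => x Kx; apply: eB; rewrite /ball /= sub0r normrN.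
have xp : 0 < hnorm x by exact: lt_trans Kx.
have hp : 0 < hnorm x `^ p by exact: powR_gt0.
rewrite ger0_norm ?divr_ge0 ?hnorm_ge0 ?(ltW hp) // ltr_pdivrMr //.
rewrite -(@ltr_pXn2r _ 2) ?nnegrE ?hnorm_ge0 ?mulr_ge0 ?(ltW e0) ?(ltW hp) //.
pose eta := e ^+ 2 / 8 * (hnorm x `^ p * hnorm x `^ p).
(* Since f x is the rescaling of index 0 and |x| > K, the uniform estimate holds for every n and
   passes to the limit I x. *)
have close n : anorm (inner (f x) (rescaling f n x) - inner x x) <= eta.
  rewrite -{1}[f x]rescaling0; apply: inner_rescaling_le fK _ _ => //.
    exact: ltW.
  by rewrite le_max mul1r ltW.
(* This gives |f x - I x|^2 <= 4 eta = (e |x|^p)^2 / 2. *)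
apply: le_lt_trans (sqr_hnormB_le _ _ x eta _ _ _) _.
- by have := close 0; rewrite rescaling0.
- by apply: (I_limit _ _ _ _ 0) => n _; exact: close.
- by rewrite innerI subrr anorm0 mulr_ge0 ?(ltW e4) // mulr_ge0 ?(ltW hp).
have : 0 < (e * hnorm x `^ p) ^+ 2 by rewrite exprn_gt0 // mulr_gt0.
by rewrite /eta exprMn [hnorm x `^ p ^+ 2]expr2; lra.
Qed.
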